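(* Let $G$ be a finite abelian group of order $v$ with exponent $E=\exp(G)$, and let $D$ be a $(v,k,\lambda)$-SDS in $G$. Put $n=k-\lambda$ and assume $n\geq 1$. Suppose that there exist an integer $m>1$, a rational prime $p$, and an integer $j\ge 1$ such that $m\mid E$ and $p^j\equiv -1\pmod m$. Then $v_p(n)$ is even. Consequently, if $k-\lambda\ge 1$ and there are an integer $m>1$, a prime $p$ and an integer $j\geq 1$ with $m\mid E$, $p^j\equiv -1\pmod m$ and $v_p(k-\lambda)$ odd, then no $(v,k,\lambda)$-SDS exists in $G$.
   Context: Let $G$ be a finite group of order $v$, with identity denoted $0_G$. In the integral group ring $\mathbb Z[G]$, identify a subset $U\subseteq G$ with $\sum_{u\in U}u$, and for $D=\sum_{g\in G}a_g g$ write $D^{(-1)}=\sum_{g\in G}a_g g^{-1}$. A signed subset of $G$ is an element $D=\sum_{g\in G}a_g g\in\mathbb Z[G]$ with all $a_g\in\{0,1,-1\}$; its support size is $k=|\{g\in G: a_g\neq 0\}|$. A signed subset $D$ of support size $k$ is a $(v,k,\lambda)$-signed difference set (SDS), with $\lambda\in\mathbb Z$, if $DD^{(-1)}=(k-\lambda)0_G+\lambda G$ in $\mathbb Z[G]$ (so the coefficient of the identity is $k$ and every other coefficient is $\lambda$). For a prime $p$ and a positive integer $n$, $v_p(n)$ is the largest integer $e\ge 0$ with $p^e\mid n$. The exponent $\exp(G)$ is the least positive integer $E$ such that $E$-fold multiples of all elements of $G$ are the identity. *)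

(* Defs.v *)
From HB Require Import structures.
From mathcomp Require Import all_boot all_order all_algebra all_fingroup.
From mathcomp Require Import all_solvable.

Set Implicit Arguments.
Unset Strict Implicit.
Unset Printing Implicit Defensive.

Import GRing.Theory.

Local Open Scope ring_scope.

(* The integral group ring Z[gT].  The alias is needed because the canonical  *)
(* ring structure of {ffun gT -> int} is the pointwise one; here the product  *)
(* is convolution.                                                            *)
Definition int_group_ring (gT : finGroupType) : Type := {ffun gT -> int}.

HB.instance Definition _ (gT : finGroupType) :=
  GRing.Zmodule.copy (int_group_ring gT) {ffun gT -> int}.

Section IntGroupRing.

Variable gT : finGroupType.
Implicit Types (D : int_group_ring gT) (g : gT) (U : {set gT}).

Definition gr_coef D : gT -> int := fun_of_fin D.

Definition gr_elt g : int_group_ring gT := [ffun h => (h == g)%:Z].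

Definition gr_mul D1 D2 : int_group_ring gT :=
  [ffun g => \sum_h gr_coef D1 h * gr_coef D2 (h^-1 * g)%g].

Lemma gr_coefP D1 D2 : gr_coef D1 =1 gr_coef D2 -> D1 = D2.
Proof. by move=> eqD; apply/ffunP. Qed.

Lemma gr_coef0 g : gr_coef 0 g = 0.
Proof. by rewrite /gr_coef ffunE. Qed.

Lemma gr_coefD D1 D2 g : gr_coef (D1 + D2) g = gr_coef D1 g + gr_coef D2 g.
Proof. by rewrite /gr_coef ffunE. Qed.

Lemma gr_coef_elt g h : gr_coef (gr_elt g) h = (h == g)%:Z.
Proof. by rewrite /gr_coef ffunE. Qed.

Lemma gr_coef_mul D1 D2 g :
  gr_coef (gr_mul D1 D2) g = \sum_h gr_coef D1 h * gr_coef D2 (h^-1 * g)%g.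
Proof. by rewrite {1}/gr_coef ffunE. Qed.

Lemma gr_mulA : associative gr_mul.
Proof.
move=> A B C; apply: gr_coefP => g; rewrite !gr_coef_mul.
under eq_bigr => h _ do rewrite gr_coef_mul mulr_sumr.
under [RHS]eq_bigr => x _ do rewrite gr_coef_mul mulr_suml.
rewrite [RHS]exchange_big; apply: eq_bigr => h _ /=.
rewrite [RHS](reindex_inj (mulgI h)); apply: eq_bigr => x _.
by rewrite mulKg mulrA invMg mulgA.
Qed.

Lemma gr_mul1r : left_id (gr_elt 1%g) gr_mul.
Proof.
move=> A; apply: gr_coefP => g; rewrite gr_coef_mul (bigD1 1%g) //= big1.
  by rewrite gr_coef_elt eqxx mul1r addr0 invg1 mul1g.
by move=> h /negPf h1; rewrite gr_coef_elt h1 mul0r.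
Qed.

Lemma gr_mulr1 : right_id (gr_elt 1%g) gr_mul.
Proof.
move=> A; apply: gr_coefP => g; rewrite gr_coef_mul (bigD1 g) //= big1.
  by rewrite gr_coef_elt mulVg eqxx mulr1 addr0.
move=> h hg; rewrite gr_coef_elt; case: eqP; rewrite ?mulr0 // => e.
by case/eqP: hg; rewrite -[g](mulKVg h) e mulg1.
Qed.

Lemma gr_mulDl : left_distributive gr_mul +%R.
Proof.
move=> A B C; apply: gr_coefP => g; rewrite gr_coefD !gr_coef_mul -big_split.
by apply: eq_bigr => h _; rewrite gr_coefD mulrDl.
Qed.

Lemma gr_mulDr : right_distributive gr_mul +%R.
Proof.
move=> A B C; apply: gr_coefP => g; rewrite gr_coefD !gr_coef_mul -big_split.
by apply: eq_bigr => h _; rewrite gr_coefD mulrDr.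
Qed.

Lemma gr_elt1_neq0 : gr_elt 1%g != 0.
Proof.
by apply/eqP => /(congr1 (gr_coef^~ 1%g)); rewrite gr_coef_elt gr_coef0 eqxx.
Qed.

HB.instance Definition _ :=
  GRing.Zmodule_isNzRing.Build (int_group_ring gT)
    gr_mulA gr_mul1r gr_mulr1 gr_mulDl gr_mulDr gr_elt1_neq0.

Lemma gr_coefM D1 D2 g :
  gr_coef (D1 * D2) g = \sum_h gr_coef D1 h * gr_coef D2 (h^-1 * g)%g.
Proof. exact: gr_coef_mul. Qed.

Lemma gr_eltM g h : gr_elt (g * h)%g = gr_elt g * gr_elt h.
Proof.
apply: gr_coefP => x; rewrite gr_coefM (bigD1 g) //= big1.
  by rewrite !gr_coef_elt eqxx mul1r addr0 -(inj_eq (mulgI g^-1%g)) mulKg.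
by move=> y /negPf yg; rewrite gr_coef_elt yg mul0r.
Qed.

Definition gr_set U : int_group_ring gT := \sum_(u in U) gr_elt u.

(* D^(-1) *)
Definition gr_inv D : int_group_ring gT :=
  \sum_g gr_elt g^-1%g *~ gr_coef D g.

Definition signed_subset D : Prop :=
  forall g, gr_coef D g \in [:: 0; 1; -1].

Definition gr_supp D : {set gT} := [set g | gr_coef D g != 0].

Definition is_SDS (v k : nat) (lambda : int) D : Prop :=
  [/\ #|gT| = v, signed_subset D, #|gr_supp D| = k &
      D * gr_inv D
        = gr_elt 1%g *~ (k%:Z - lambda) + gr_set [set: gT] *~ lambda].

End IntGroupRing.

(* Main.v *)
Require Import Defs.
From HB Require Import structures.
From mathcomp Require Import all_boot all_order all_algebra all_fingroup.
From mathcomp Require Import all_solvable all_field.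
From mathcomp Require Import ring.

Import Order.TTheory GRing.Theory Num.Theory.

Local Open Scope ring_scope.

(** Since m divides the exponent of G, there is a homomorphism chi from G to
    the complex m-th roots of unity that takes a primitive m-th root z as a
    value ([abelian_log_exponent]).  As chi is nontrivial, it kills the sum of
    all elements of G, so applying it to the defining equation of D gives
    A * A^* = n with A = chi(D) in Z[z] ([SDS_char_norm]).

    It remains to see that an integer n > 0 of the form A * A^*, with A in
    Z[z], has even p-adic valuation ([even_logn_norm]).  The usual argument is
    that p is unramified in Z[z] and that each prime above p is stable under
    conjugation.  Here is a version without prime ideals.  Put q = p ^ j.
    Because q = -1 modulo m, conjugation sends z to z ^ q, hence by Frobenius
    it is the map x |-> x ^ q modulo p ([conj_zeval_Frobenius]).  If p divides
    n, then A ^ (q + 1) = A * A^* = 0 modulo p, whereas conjugating twice gives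
    A = A ^ (q ^ 2) modulo p; as q ^ 2 >= q + 1, p divides A in Z[z]
    ([dvdp_zeval]).  Writing A = p * B, the number B * B^* = n / p ^ 2 is
    rational and an algebraic integer, hence an integer, and the valuation has
    dropped by 2: induction on n concludes. *)

(** * A homomorphism onto the integers modulo the exponent *)

(** An element of maximal order in an abelian group generates a direct factor;
    the discrete logarithm of the projection onto that factor is additive
    modulo the exponent and takes the value 1 at the generator. *)
Lemma abelian_log_exponent (gT : finGroupType) :
  abelian [set: gT] ->
  exists2 a : gT -> nat,
    forall g h, a (g * h)%g = a g + a h %[mod exponent [set: gT]]
  & exists x, a x = 1%N %[mod exponent [set: gT]].
Proof.
move=> abG; have [x Gx ox] := exponent_witness (abelian_nil abG).
have /splitsP[H complH] := abelian_splits Gx (esym ox) abG.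
have cHx : H \subset 'C(<[x]>)%g.
  by apply: (sub_abelian_cent2 abG); rewrite subsetT.
have /complP[_ defG] := complH.
pose f := divgr <[x]> H.
have fP g : exists i, f g == (x ^+ i)%g.
  have /cycleP[i ->] : f g \in <[x]>%g by rewrite mem_divgr // defG inE.
  by exists i.
exists (fun g => ex_minn (fP g)).
  move=> g h; rewrite ox; apply/eqP; rewrite -eq_expg_mod_order expgD.
  do 3!case: ex_minnP => ? /eqP<- _.
  by rewrite /f (divgrM complH cHx) ?inE.
exists x; rewrite ox; apply/eqP; rewrite -eq_expg_mod_order.
by case: ex_minnP => ? /eqP<- _; rewrite /f divgr_id ?cycle_id ?expg1.
Qed.

(** * Frobenius congruence for integer polynomials *)

(** The p-th power map is additive in characteristic p and fixes the
    coefficients by Fermat's little theorem. *)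
Lemma pcharFp_exp_comp_poly (p j : nat) (P : {poly 'F_p}) :
  prime p -> P ^+ (p ^ j) = P \Po 'X^(p ^ j).
Proof.
move=> p_pr; have chP : p \in [pchar {poly 'F_p}].
  by rewrite pchar_poly pchar_Fp.
have frob1 (Q : {poly 'F_p}) : Q ^+ p = Q \Po 'X^p.
  elim/poly_ind: Q => [|Q c IH].
    by rewrite comp_poly0 expr0n gtn_eqF ?prime_gt0.
  have -> : (Q * 'X + c%:P) ^+ p = Q ^+ p * 'X^p + (c ^+ p)%:P.
    rewrite -!(pFrobenius_autE chP) pFrobenius_autD_comm; last exact: mulrC.
    rewrite pFrobenius_autM_comm ?(pFrobenius_autE chP) ?polyC_exp //.
    exact: mulrC.
  have -> : c ^+ p = c by have := expf_card c; rewrite card_Fp.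
  by rewrite IH comp_polyD comp_polyM comp_polyX comp_polyC.
elim: j => [|j IH]; first by rewrite expn0 comp_polyXr.
by rewrite expnSr exprM IH frob1 -comp_polyA comp_Xn_poly -exprM mulnC.
Qed.

(** With q = p ^ j, the difference P('X^q) - P ^ q vanishes after reduction to
    'F_p, so p divides each of its coefficients. *)
Lemma exp_comp_poly_modp (p j : nat) (P : {poly int}) :
  prime p -> exists Q : {poly int}, P \Po 'X^(p ^ j) = P ^+ (p ^ j) + p%:R * Q.
Proof.
move=> p_pr; pose r : {rmorphism int -> 'F_p} := intr.
pose Q := P \Po 'X^(p ^ j) - P ^+ (p ^ j).
have Q0 : map_poly r Q = 0.
  by rewrite /Q rmorphB rmorphXn /= map_comp_poly map_polyXn
    -pcharFp_exp_comp_poly ?subrr.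
exists (map_poly (divz^~ p%:Z) Q); rewrite -[LHS](subrKC (P ^+ (p ^ j))).
congr (_ + _); apply/polyP => i.
rewrite -/Q -[p%:R]/(p%:Z%:~R) mulr_natl coefMn coef_map_id0 ?div0z //.
rewrite -mulr_natr natz divzK //.
by rewrite (dvdz_pcharf (pchar_Fp p_pr)) -[_%:~R]/(r _) -coef_map Q0 coef0.
Qed.

(** * Self-conjugate primes in a ring of cyclotomic integers *)

Lemma conjC_unity_root (z : algC) (n : nat) :
  (0 < n)%N -> z ^+ n = 1 -> z^* = z^-1.
Proof.
move=> n_gt0 zn1; have z1 : `|z| = 1.
  by apply/eqP; rewrite -(@pexpr_eq1 _ _ n) // -normrX zn1 normr1.
by rewrite invC_norm z1 expr1n invr1 mul1r.
Qed.

(** Elements of Z[z] are handled through the integer polynomials that represent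
    them, so that divisibility by p in Z[z] is witnessed by a polynomial. *)
Definition zeval (z : algC) (P : {poly int}) : algC := (map_poly intr P).[z].

Lemma zevalD z : {morph zeval z : P Q / P + Q}.
Proof. by move=> P Q; rewrite /zeval rmorphD hornerD. Qed.

Lemma zevalM z : {morph zeval z : P Q / P * Q}.
Proof. by move=> P Q; rewrite /zeval rmorphM hornerM. Qed.

Lemma zevalX z P n : zeval z (P ^+ n) = zeval z P ^+ n.
Proof. by rewrite /zeval rmorphXn horner_exp. Qed.

Lemma zeval_nat z n : zeval z n%:R = n%:R.
Proof. by rewrite /zeval rmorph_nat -polyC_natr hornerC. Qed.

Lemma zevalC z c : zeval z c%:P = c%:~R.
Proof. by rewrite /zeval map_polyC hornerC. Qed.

Lemma zevalN z P : zeval z (- P) = - zeval z P.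
Proof. by rewrite /zeval rmorphN hornerN. Qed.

Lemma zeval_comp_Xn z P n : zeval z (P \Po 'X^n) = zeval (z ^+ n) P.
Proof. by rewrite /zeval map_comp_poly map_polyXn horner_comp hornerXn. Qed.

Lemma conj_zeval z P : (zeval z P)^* = zeval (z^*) P.
Proof.
rewrite /zeval -horner_map -map_poly_comp; congr (_.[_]).
by apply: eq_map_poly => c /=; rewrite rmorph_int.
Qed.

Lemma Aint_zeval z P : z \in Aint -> zeval z P \in Aint.
Proof.
move=> zA; rewrite /zeval horner_coef rpred_sum // => i _.
by rewrite coef_map rpredM ?rpredX ?Aint_int.
Qed.

Section SelfConjugate.

Variables (p j : nat) (z : algC).
Hypotheses (p_pr : prime p) (zq1 : z ^+ (p ^ j).+1 = 1).
Let q := (p ^ j)%N.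

Let conjz : z^* = z ^+ q.
Proof.
rewrite (conjC_unity_root _ _ _ zq1) //.
have z_nz : z != 0.
  by apply: contra_eq_neq zq1 => ->; rewrite expr0n /= eq_sym oner_neq0.
by apply: (mulfI z_nz); rewrite mulfV // -exprS zq1.
Qed.

(** Conjugation replaces z by z ^ q in P(z), and P('X^q) agrees with P ^ q
    modulo p. *)
Lemma conj_zeval_Frobenius P :
  exists Q, (zeval z P)^* = zeval z P ^+ q + p%:R * zeval z Q.
Proof.
have [Q eqQ] := exp_comp_poly_modp p j P p_pr; exists Q.
by rewrite conj_zeval conjz -zeval_comp_Xn eqQ zevalD zevalM zevalX zeval_nat.
Qed.

Hypothesis j_gt0 : (0 < j)%N.

(** Modulo p the hypothesis says that A = P(z) satisfies A ^ (q + 1) = 0, and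
    A is a power of itself with the larger exponent q ^ 2 = p ^ (j + j). *)
Lemma dvdp_zeval P (N : int) :
  zeval z P * (zeval z P)^* = p%:R * N%:~R ->
  exists Q, zeval z P = p%:R * zeval z Q.
Proof.
have [Q1 eQ1] := conj_zeval_Frobenius P; set A := zeval z P in eQ1 *.
move=> eN; have AS : A ^+ q.+1 = p%:R * zeval z (N%:P - P * Q1).
  rewrite zevalD zevalN zevalM zevalC -/A mulrBr -eN eQ1 exprS; ring.
have [Q2 eQ2] := exp_comp_poly_modp p (j + j) P p_pr.
(* Applying z |-> z ^ q twice is conjugating twice. *)
have zqq : z ^+ (p ^ (j + j)) = z.
  by rewrite expnD exprM -conjz -rmorphXn /= -conjz conjCK.
have AE : A = A ^+ (p ^ (j + j)) + p%:R * zeval z Q2.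
  have := congr1 (zeval z) eQ2.
  by rewrite zeval_comp_Xn zqq zevalD zevalM zevalX zeval_nat.
have q_gt1 : (1 < q)%N by rewrite -(exp1n j) ltn_exp2r ?prime_gt1.
have leq_qq : (q.+1 <= p ^ (j + j))%N.
  rewrite expnD -/q; apply: leq_trans (leq_mul q_gt1 (leqnn q)).
  by rewrite mul2n -addnn -addn1 leq_add2l ltnW.
rewrite AE -(subnK leq_qq) exprD AS.
exists (P ^+ (p ^ (j + j) - q.+1) * (N%:P - P * Q1) + Q2).
by rewrite [in RHS]zevalD [in RHS]zevalM zevalX -/A mulrDr mulrCA.
Qed.

(** Descent from n to n / p ^ 2, which is again such a norm because p divides
    P(z) in Z[z] as soon as it divides n. *)
Lemma even_logn_norm P (n : nat) :
  (0 < n)%N -> zeval z P * (zeval z P)^* = n%:R -> ~~ odd (logn p n).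
Proof.
have zA : z \in Aint.
  apply: (@Aint_unity_root (p ^ j).+1) => //; exact/unity_rootP.
have [N] := ubnP n; elim: N n P => // N IH n P /ltnSE leN n_gt0 eN.
have [|pNn] := boolP (p %| n)%N; last by rewrite lognE (negPf pNn) !andbF.
case/dvdnP => n1 def_n.
have {}eN : zeval z P * (zeval z P)^* = p%:R * n1%:R.
  by rewrite eN def_n natrM mulrC.
have [Q eQ] := dvdp_zeval _ n1%:Z eN.
have p_nz : p%:R != 0 :> algC by rewrite pnatr_eq0 -lt0n prime_gt0.
have eN1 : p%:R * (zeval z Q * (zeval z Q)^*) = n1%:R.
  apply: (mulfI p_nz); rewrite -eN eQ rmorphM /= rmorph_nat; ring.
(* A rational algebraic integer is an integer. *)
have: zeval z Q * (zeval z Q)^* \is a Num.int.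
  apply: Cint_rat_Aint.
    rewrite -[_ * _](mulKf p_nz) eN1 rpredM ?rpredV ?rpred_nat //.
  by rewrite rpredM ?Aint_zeval // conj_zeval Aint_zeval // conjz rpredX.
have n1_gt0 : (0 < n1)%N by move: n_gt0; rewrite def_n muln_gt0 => /andP[].
rewrite intrEge0 ?mul_conjC_ge0 // => /natrP[n2 en2].
move: eN1; rewrite en2 -natrM => /eqP; rewrite eqr_nat => /eqP e1.
have n2_gt0 : (0 < n2)%N by move: n1_gt0; rewrite -e1 muln_gt0 => /andP[].
have p_gt0 := prime_gt0 p_pr.
rewrite def_n -e1 !lognM ?muln_gt0 ?p_gt0 // logn_prime // eqxx !oddD addTb.
rewrite addbT negbK; apply: IH en2 => //.
have pp_gt1 : (1 < p * p)%N by apply: (@ltn_mul 1 1); apply: prime_gt1.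
by apply: leq_trans leN; rewrite def_n -e1 mulnAC ltn_Pmull.
Qed.

End SelfConjugate.

(** * Evaluating the integral group ring at a character *)

Section GroupRingEval.

Variables (gT : finGroupType) (R : nzRingType) (chi : gT -> R).

Definition gr_eval (D : int_group_ring gT) : R :=
  \sum_g chi g *~ gr_coef D g.

Lemma gr_eval_is_zmod_morphism : zmod_morphism gr_eval.
Proof.
move=> D1 D2; rewrite /gr_eval -sumrB; apply: eq_bigr => g _.
by rewrite /gr_coef !ffunE mulrzBr.
Qed.

HB.instance Definition _ :=
  GRing.isZmodMorphism.Build (int_group_ring gT) R gr_eval
    gr_eval_is_zmod_morphism.

Lemma gr_eval_elt g : gr_eval (gr_elt g) = chi g.
Proof.
rewrite /gr_eval (bigD1 g) //= big1 => [|h /negPf hg].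
  by rewrite gr_coef_elt eqxx addr0.
by rewrite gr_coef_elt hg.
Qed.

Lemma gr_eval_inv D : gr_eval (gr_inv D) = \sum_g chi g^-1%g *~ gr_coef D g.
Proof.
rewrite raddf_sum; apply: eq_bigr => g _.
by rewrite raddfMz /= gr_eval_elt.
Qed.

Hypothesis chiM : forall g h, chi (g * h)%g = chi g * chi h.

Lemma gr_evalM D1 D2 : gr_eval (D1 * D2) = gr_eval D1 * gr_eval D2.
Proof.
rewrite {2}/gr_eval mulr_suml /gr_eval.
under eq_bigr => g _ do rewrite gr_coefM mulrz_sumr.
rewrite exchange_big; apply: eq_bigr => h _ /=; rewrite mulr_sumr.
rewrite (reindex_inj (mulgI h)); apply: eq_bigr => x _.
by rewrite mulKg chiM mulrzAl mulrzAr -mulrzA mulrC.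
Qed.

End GroupRingEval.

Arguments gr_eval {gT R} chi D.

(** Translation by x multiplies the sum by chi x. *)
Lemma sum_nontrivial_char (gT : finGroupType) (R : idomainType)
    (chi : gT -> R) (x : gT) :
  (forall g h, chi (g * h)%g = chi g * chi h) -> chi x != 1 ->
  \sum_g chi g = 0.
Proof.
move=> chiM chix1; apply: (mulfI (_ : chi x - 1 != 0)); rewrite ?subr_eq0 //.
rewrite mulr0 mulrBl mul1r mulr_sumr [X in _ - X](reindex_inj (mulgI x)) /=.
by under [X in _ - X]eq_bigr => g _ do rewrite chiM; rewrite subrr.
Qed.

(** A nontrivial character kills the term lambda * G of the defining equation
    and turns D^(-1) into the complex conjugate of chi(D). *)
Lemma SDS_char_norm (gT : finGroupType) (v k : nat) (lambda : int)
    (D : int_group_ring gT) (chi : gT -> algC) :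
  is_SDS v k lambda D ->
  (forall g h, chi (g * h)%g = chi g * chi h) -> (exists x, chi x != 1) ->
  (forall g, chi g^-1%g = (chi g)^*) -> chi 1%g = 1 ->
  gr_eval chi D * (gr_eval chi D)^* = (k%:Z - lambda)%:~R.
Proof.
move=> [_ _ _ eqD] chiM [x chix] chiV chi1.
have -> : (gr_eval chi D)^* = gr_eval chi (gr_inv D).
  rewrite gr_eval_inv /gr_eval rmorph_sum; apply: eq_bigr => g _ /=.
  by rewrite rmorphMz /= chiV.
rewrite -gr_evalM // eqD raddfD !raddfMz /= gr_eval_elt chi1 raddf_sum /=.
under [X in X *~ lambda]eq_bigr => g _ do rewrite gr_eval_elt.
under [X in X *~ lambda]eq_bigl => g do rewrite inE.
by rewrite (sum_nontrivial_char _ _ _ _ chiM chix) mul0rz addr0.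
Qed.

Theorem theorem3p2 (gT : finGroupType) (v k : nat) (lambda : int)
    (abG : abelian [set: gT]) (cardG : #|gT| = v) :
  (forall D : int_group_ring gT,
     is_SDS v k lambda D ->
     1 <= k%:Z - lambda ->
     forall m p j : nat,
       (1 < m)%N -> prime p -> (1 <= j)%N ->
       (m %| exponent [set: gT])%N ->
       ((p ^ j)%N%:Z = -1 %[mod m%:Z])%Z ->
       ~~ odd (logn p (absz (k%:Z - lambda)%R)))
  /\
  (1 <= k%:Z - lambda ->
   (exists m p j : nat,
      [/\ (1 < m)%N, prime p & (1 <= j)%N] /\
      [/\ (m %| exponent [set: gT])%N,
          ((p ^ j)%N%:Z = -1 %[mod m%:Z])%Z &
          odd (logn p (absz (k%:Z - lambda)%R))]) ->
   ~ exists D : int_group_ring gT, is_SDS v k lambda D).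
Proof.
suff even_part (D : int_group_ring gT) :
     is_SDS v k lambda D ->
     1 <= k%:Z - lambda ->
     forall m p j : nat,
       (1 < m)%N -> prime p -> (1 <= j)%N ->
       (m %| exponent [set: gT])%N ->
       ((p ^ j)%N%:Z = -1 %[mod m%:Z])%Z ->
       ~~ odd (logn p (absz (k%:Z - lambda)%R)).
  split=> // n_ge1 [m] [p] [j] [[m_gt1 p_pr j_ge1] [m_dvd pj odd_n]] [D sdsD].
  have := even_part D sdsD n_ge1 m p j m_gt1 p_pr j_ge1 m_dvd pj.
  by rewrite odd_n.
move=> sdsD n_ge1 m p j m_gt1 p_pr j_ge1 m_dvd pj.
have [z z_prim] := C_prim_root_exists (ltnW m_gt1).
have [a aM [x ax1]] := abelian_log_exponent gT abG.
have z_a i1 i2 : i1 = i2 %[mod exponent [set: gT]] -> z ^+ i1 = z ^+ i2.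
  move=> e; apply/eqP; rewrite (eq_prim_root_expr z_prim).
  by rewrite -(modn_dvdm i1 m_dvd) e modn_dvdm.
pose chi g := z ^+ a g.
have chiM g h : chi (g * h)%g = chi g * chi h.
  by rewrite /chi -exprD; apply/z_a/aM.
have z_nz : z != 0 by rewrite (prim_root_eq0 z_prim) -lt0n ltnW.
have chi1 : chi 1%g = 1.
  apply: (mulfI (_ : chi 1%g != 0)); first by rewrite expf_neq0.
  by rewrite -chiM mul1g mulr1.
have chiV g : chi g^-1%g = (chi g)^*.
  have chi_m : chi g ^+ m = 1.
    by rewrite /chi -exprM mulnC exprM (prim_expr_order z_prim) expr1n.
  rewrite (conjC_unity_root _ m (ltnW m_gt1) chi_m).
  apply: (mulfI (_ : chi g != 0)); first by rewrite expf_neq0.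
  by rewrite -chiM mulgV chi1 mulfV ?expf_neq0.
have chix : chi x != 1.
  by rewrite /chi (z_a _ _ ax1) -(prim_order_dvd z_prim) dvdn1 gtn_eqF.
have zq1 : z ^+ (p ^ j).+1 = 1.
  apply/eqP; rewrite -(prim_order_dvd z_prim) -(dvdzE m%:Z (p ^ j)%N.+1%:Z).
  by rewrite -addn1 PoszD -[1%:Z]opprK -eqz_mod_dvd; apply/eqP.
(* The polynomial P represents chi(D) in Z[z]. *)
pose P : {poly int} := \sum_g gr_coef D g *: 'X^(a g).
have evP : zeval z P = gr_eval chi D.
  rewrite /zeval rmorph_sum horner_sum; apply: eq_bigr => g _.
  by rewrite /= map_polyZ map_polyXn hornerZ hornerXn mulrzl.
have n_ge0 : 0 <= k%:Z - lambda by rewrite (le_trans _ n_ge1).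
apply: (even_logn_norm p j z p_pr zq1 j_ge1 P).
  by rewrite absz_gt0 gt_eqF // (lt_le_trans _ n_ge1).
rewrite evP (SDS_char_norm gT v k lambda D chi) //; last by exists x.
by rewrite -{1}(gez0_abs n_ge0).
Qed.
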